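(* Let $(p,q)$ be a non-strict pair of distinct points in a normed plane $(\mathbb{R}^2,\|\cdot\|)$, and let $t_p,t_q,b_p,b_q,s_t,s_b$ be the associated points defined in the context. Then the bisector $\operatorname{bis}(p,q)$ has interior points and is fully contained in the interior of the bent strip $$\operatorname{conv}\bigl([p,t_p\rangle\cup[q,t_q\rangle\bigr)\cup\operatorname{conv}\bigl([p,b_p\rangle\cup[q,b_q\rangle\bigr).$$ More precisely, $\operatorname{bis}(p,q)=B_1\cup B_2\cup B_3$, where $$B_2=\operatorname{conv}\bigl([s_t,p\rangle_-\cup[s_t,q\rangle_-\bigr),\qquad B_3=\operatorname{conv}\bigl([s_b,p\rangle_-\cup[s_b,q\rangle_-\bigr),$$ and $B_1$ is a set for which there is a homeomorphism $f:[0,1]\to B_1$ with $f(0)=s_b$ and $f(1)=s_t$.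
   Context: $(\mathbb{R}^2,\|\cdot\|)$ is an arbitrary two-dimensional real normed space (no strict convexity or smoothness assumed) with unit ball $B=\{x:\|x\|\le 1\}$ and unit circle $\operatorname{bd}(B)$; $\operatorname{conv}$ denotes convex hull. The bisector of $p\neq q$ is $\operatorname{bis}(p,q)=\{z\in\mathbb{R}^2:\|z-p\|=\|z-q\|\}$. The pair $(p,q)$ is called strict if $\operatorname{bd}(B)$ contains no (nondegenerate) line segment parallel to $p-q$; otherwise it is non-strict. For distinct $x,y$: $\langle x,y\rangle=\{\lambda y+(1-\lambda)x:\lambda\in\mathbb{R}\}$ (line), $[x,y\rangle=\{\lambda y+(1-\lambda)x:\lambda\ge 0\}$ (ray from $x$ through $y$), $[x,y\rangle_-=\{\lambda y+(1-\lambda)x:\lambda\le 0\}$ (the opposite ray). Orientation: one of the two sides of the line $\langle p,q\rangle$ is called ''above'', the other ''below'' (i.e. fix a nonzero linear functional $\psi$ with $\psi(p-q)=0$ and let ''above'' mean larger $\psi$). On lines parallel to $\langle p,q\rangle$, ''left to right'' is the direction of $q-p$. Points: the translates $p+B$ and $q+B$ have two common supporting lines parallel to $\langle p,q\rangle$: $L_{\text{top}}$ above $\langle p,q\rangle$ and $L_{\text{bottom}}$ below it. Write $L_{\text{top}}\cap(\operatorname{bd}(B)+p)=[t_p,t_p']$, where $t_p$ is the left and $t_p'$ the right endpoint; $L_{\text{top}}\cap(\operatorname{bd}(B)+q)=[t_q',t_q]$, where $t_q'$ is the left and $t_q$ the right endpoint; $L_{\text{bottom}}\cap(\operatorname{bd}(B)+p)=[b_p,b_p']$,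 where $b_p$ is the left and $b_p'$ the right endpoint; $L_{\text{bottom}}\cap(\operatorname{bd}(B)+q)=[b_q',b_q]$, where $b_q'$ is the left and $b_q$ the right endpoint. Let $s_t$ be the intersection point of the rays $[p,t_p'\rangle$ and $[q,t_q'\rangle$, and $s_b$ the intersection point of the rays $[p,b_p'\rangle$ and $[q,b_q'\rangle$. *)

(* Defs.v *)
From HB Require Import structures.
From mathcomp Require Import all_boot all_order all_algebra.
From mathcomp Require Import all_classical all_reals all_analysis.
Set Implicit Arguments.
Unset Strict Implicit.
Unset Printing Implicit Defensive.
Import Order.TTheory GRing.Theory Num.Theory.
Import numFieldNormedType.Exports.
Local Open Scope classical_set_scope.
Local Open Scope ring_scope.

Section NormedPlane.
Context {R : realType} {V : normedModType R}.
Implicit Types (p q x y a b d : V) (A K L S : set V).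

Definition unit_ball : set V := [set x | `|x| <= 1].

Definition bd A : set V := closure A `\` interior A.

Definition translate p A : set V := [set p + z | z in A].

Definition convex_hull A : set V := smallest (@convex_set R V) A.

Definition affine_comb x y (lambda : R) : V := lambda *: y + (1 - lambda) *: x.

Definition seg x y : set V :=
  [set affine_comb x y lambda | lambda in [set l | 0 <= l <= 1]].

Definition line x y : set V := [set affine_comb x y lambda | lambda in setT].

Definition ray x y : set V :=
  [set affine_comb x y lambda | lambda in [set l | 0 <= l]].

Definition opp_ray x y : set V :=
  [set affine_comb x y lambda | lambda in [set l | l <= 0]].

Definition bis p q : set V := [set z | `|z - p| = `|z - q|].

Definition strict_pair p q : Prop :=
  ~ exists x y, [/\ x <> y, seg x y `<=` bd unit_ball
                  & exists c : R, y - x = c *: (p - q)].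

(* The zero functional is excluded, so [L] is a line when [V] is a plane. *)
Definition supporting_line K L : Prop :=
  exists (phi : {scalar V}) (c : R),
    [/\ exists v, phi v <> 0,
        L = [set z | phi z = c],
        K `<=` [set z | phi z <= c]
      & L `&` K !=set0].

Definition parallel_lines L L' : Prop := exists a, L = translate a L'.

(* [L] lies strictly on the positive side of the line [psi = psi p]; it is the
   line below when used with [- psi] in place of [psi]. *)
Definition common_support (psi : V -> R) p q L : Prop :=
  [/\ supporting_line (translate p unit_ball) L,
      supporting_line (translate q unit_ball) L,
      parallel_lines L (line p q)
    & forall z, L z -> psi p < psi z].

(* [S] is the segment with left endpoint [a] and right endpoint [b], where
   "left to right" is the direction of [d]; the segment may be a point. *)
Definition left_right_seg d S a b : Prop :=
  S = seg a b /\ exists2 c : R, 0 <= c & b - a = c *: d.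

(* [f] restricts to a homeomorphism from [D] onto [E] (with their subspace
   topologies); its values outside [D] are irrelevant. *)
Definition homeomorphism_between {T U : topologicalType}
    (D : set T) (E : set U) (f : T -> U) : Prop :=
  [/\ set_bij D E f, {within D, continuous f}
    & exists2 g : U -> T, {within E, continuous g}
                        & forall t, D t -> g (f t) = t].

End NormedPlane.

Arguments unit_ball {R} V.

(* Main.v *)
Require Import Defs.
From HB Require Import structures.
From mathcomp Require Import all_boot all_order all_algebra.
From mathcomp Require Import all_classical all_reals all_analysis.
From mathcomp Require Import ring lra.
Import Order.TTheory GRing.Theory Num.Theory.
Import numFieldNormedType.Exports.
Local Open Scope classical_set_scope.
Local Open Scope ring_scope.

(** Write [d = q - p] and let [F] be the face of the unit ball on which a
    functional [psi] vanishing on [d] attains its maximum [h].  The four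
    segments cut out on the two supporting lines are [p + F], [q + F], [p - F]
    and [q - F].  If [F] goes from [a] to [a + w d], then the rays defining [st]
    can meet only if [w > 0], and in the affine coordinates
    [chart x y = p + x d + y a] every point of the figure is explicit:
    [p = (0, 0)], [q = (1, 0)], [tp = (0, 1)], [tq = (1 + w, 1)],
    [bp = (-w, -1)], [bq = (1, -1)], [st = (1, 1/w)], [sb = (0, -1/w)]
    ([bis_structure] is the theorem in these coordinates).

    On the parallel to [pq] at height [y], the point with abscissa [x] has
    distance [g x] from [p] and [g (x - 1)] from [q], where [g] is convex.
    Moreover [g] takes its minimum [|y|] exactly on the segment between [0] and
    [w y], because this is where the line crosses the scaled face [y F].  Hence
    [g] is strictly decreasing, then constant on an interval of length [w |y|],
    then strictly increasing (a [bowl]), and the bisector on this line is the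
    solution set of [g x = g (x - 1)]:
    - a solution cannot have both [x - 1] and [x] on a strictly monotone branch,
      so it is at distance less than [1] to the right of the flat part or in it;
      this is the open bent strip ([bowl_shift_bounds]);
    - if the flat part has length at least [1], that is if [w |y| >= 1], then
      both [x - 1] and [x] lie in it, and these solutions fill the two wedges
      with apices [st] and [sb] ([bowl_shift_wide]);
    - if [w |y| <= 1], then [x - 1] is left and [x] is right of the flat part,
      up to end points, and [g x - g (x - 1)] changes sign exactly once
      ([bowl_shift_left], [bowl_shift_right]).  The solution is unique, and the
      strict sign change makes it depend continuously on [y].  Its graph is the
      curve joining [sb] to [st], with the height as inverse parameter. *)

(** * Functions that decrease, stay flat and then increase *)

(** What remains of convexity once the set of minimizers [[l, r]] is known: the
    equation [g x = g (x - 1)] is governed by monotonicity alone. *)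
Record bowl {R : realType} (g : R -> R) (l r : R) : Prop := {
  bowl_le : l <= r ;
  bowl_dec : forall x x', x < x' -> x' <= l -> g x' < g x ;
  bowl_flat : forall x, l <= x <= r -> g x = g l ;
  bowl_inc : forall x x', x < x' -> r <= x -> g x < g x' }.

Section Bowls.
Context {R : realType}.
Implicit Types (g : R -> R) (l r x m : R).

(** A convex function decreases strictly left of its minimizers: [x'] between
    [x] and [l] is a proper convex combination of them, and [g l < g x].  The
    right side is symmetric. *)
Lemma convex_bowl g l r m :
  (forall x x' t, 0 <= t <= 1 ->
     g (t * x + (1 - t) * x') <= t * g x + (1 - t) * g x') ->
  l <= r -> (forall x, m <= g x) -> (forall x, g x = m <-> l <= x <= r) ->
  bowl g l r.
Proof.
move=> cvx lr mg gm.
have gl : g l = m by apply/gm; rewrite lexx lr.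
have gr : g r = m by apply/gm; rewrite lexx lr.
have gt_m x : ~ (l <= x <= r) -> m < g x.
  by move=> nx; rewrite lt_neqAle mg andbT; apply/eqP => /esym/gm.
split => //.
- move=> x x' xx' x'l; have xl : x < l by lra.
  have mx : m < g x by apply: gt_m; lra.
  pose t := (l - x') / (l - x).
  have dt : t * (l - x) = l - x' by rewrite /t divfK//; lra.
  have t01 : 0 <= t <= 1 by nra.
  have t1 : t < 1 by nra.
  have := cvx x l t t01; rewrite gl.
  have -> : t * x + (1 - t) * l = x' by lra.
  by move=> /le_lt_trans; apply; nra.
- by move=> x xlr; rewrite gl; apply/gm.
- move=> x x' xx' rx; have rx' : r < x' by lra.
  have mx : m < g x' by apply: gt_m; lra.
  pose t := (x - r) / (x' - r).
  have dt : t * (x' - r) = x - r by rewrite /t divfK//; lra.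
  have t01 : 0 <= t <= 1 by nra.
  have t1 : t < 1 by nra.
  have := cvx x' r t t01; rewrite gr.
  have -> : t * x' + (1 - t) * r = x by lra.
  by move=> /le_lt_trans; apply; nra.
Qed.

Lemma bowl_inc_le g l r x x' : bowl g l r -> l <= x -> x <= x' -> g x <= g x'.
Proof.
move=> bg lx xx'; have lr := bowl_le _ _ _ bg; have [x'r|rx'] := leP x' r.
  by rewrite !(bowl_flat _ _ _ bg) //; lra.
have [rx|xr] := leP r x.
  by move: xx'; rewrite le_eqVlt => /predU1P[->//|xx'];
     rewrite ltW// (bowl_inc _ _ _ bg).
rewrite (bowl_flat _ _ _ bg x); last lra.
rewrite -(bowl_flat _ _ _ bg r); last lra.
by apply/ltW/(bowl_inc _ _ _ bg).
Qed.

Lemma bowl_gt_flat g l r x x' :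
  bowl g l r -> l <= x <= r -> ~ (l <= x' <= r) -> g x < g x'.
Proof.
move=> bg xlr nx'; have lr := bowl_le _ _ _ bg; rewrite (bowl_flat _ _ _ bg)//.
have [x'l|lx'] := ltP x' l; first by rewrite (bowl_dec _ _ _ bg).
rewrite -(bowl_flat _ _ _ bg r); last by lra.
by apply: (bowl_inc _ _ _ bg) => //; lra.
Qed.

(** Otherwise [x - 1] and [x] lie on the same strictly monotone branch. *)
Lemma bowl_shift_bounds g l r x :
  bowl g l r -> g x = g (x - 1) -> l < x < r + 1.
Proof.
move=> bg gx; apply/andP; split; rewrite ltNge; apply/negP => xE.
  by have := bowl_dec _ _ _ bg (x - 1) x ltac:(lra) xE; rewrite gx ltxx.
by have := bowl_inc _ _ _ bg (x - 1) x ltac:(lra) ltac:(lra); rewrite gx ltxx.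
Qed.

(** If only one of [x - 1] and [x] were in the flat part, the values would
    differ; and a flat part of length at least [1] cannot fit strictly between
    them. *)
Lemma bowl_shift_wide g l r x : bowl g l r -> l + 1 <= r ->
  g x = g (x - 1) <-> l + 1 <= x <= r.
Proof.
move=> bg lr; split => [gx|xlr]; last by rewrite !(bowl_flat _ _ _ bg)//; lra.
have := bowl_shift_bounds _ _ _ _ bg gx => bx.
apply/andP; split; rewrite leNgt; apply/negP => xE.
  by have := bowl_gt_flat _ _ _ x (x - 1) bg ltac:(lra) ltac:(lra);
     rewrite gx ltxx.
by have := bowl_gt_flat _ _ _ (x - 1) x bg ltac:(lra) ltac:(lra);
     rewrite gx ltxx.
Qed.

(** A flat part of length less than [1] cannot contain both [x - 1] and [x], so
    it contains neither and separates them; at length [1] they may be its end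
    points. *)
Lemma bowl_shift_narrow g l r x : bowl g l r -> r <= l + 1 ->
  g x = g (x - 1) -> r <= x <= l + 1.
Proof.
move=> bg lr gx; have := bowl_shift_bounds _ _ _ _ bg gx => bx.
apply/andP; split; rewrite leNgt; apply/negP => xE.
  by have := bowl_gt_flat _ _ _ x (x - 1) bg ltac:(lra) ltac:(lra);
     rewrite gx ltxx.
by have := bowl_gt_flat _ _ _ (x - 1) x bg ltac:(lra) ltac:(lra);
     rewrite gx ltxx.
Qed.

(** Moving left from a solution [x0] strictly raises [g (x - 1)], because
    [x0 - 1 <= l]; meanwhile [g x] cannot rise until [x] itself is left of [l],
    and there [g] is decreasing. *)
Lemma bowl_shift_left g l r x0 x : bowl g l r -> r <= l + 1 ->
  g x0 = g (x0 - 1) -> x < x0 -> g x < g (x - 1).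
Proof.
move=> bg lr gx0 xx0; have bx0 := bowl_shift_narrow _ _ _ _ bg lr gx0.
have [xl|lx] := leP x l; first by apply: (bowl_dec _ _ _ bg) => //; lra.
apply: (@le_lt_trans _ _ (g x0)).
  by apply: (bowl_inc_le _ _ _ _ _ bg); lra.
by rewrite gx0; apply: (bowl_dec _ _ _ bg); lra.
Qed.

Lemma bowl_opp g l r : bowl g l r -> bowl (fun x => g (- x)) (- r) (- l).
Proof.
move=> bg; have lr := bowl_le _ _ _ bg; split.
- lra.
- by move=> x x' xx' x'r; apply: (bowl_inc _ _ _ bg); lra.
- by move=> x xrl; rewrite !(bowl_flat _ _ _ bg)//; lra.
- by move=> x x' xx' x'r; apply: (bowl_dec _ _ _ bg); lra.
Qed.

(** The mirror image of [bowl_shift_left]: reflection turns the solution [x0]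
    into [1 - x0]. *)
Lemma bowl_shift_right g l r x0 x : bowl g l r -> r <= l + 1 ->
  g x0 = g (x0 - 1) -> x0 < x -> g (x - 1) < g x.
Proof.
move=> bg lr gx0 xx0.
have := bowl_shift_left _ _ _ (1 - x0) (1 - x) (bowl_opp _ _ _ bg).
have e1 (z : R) : - (1 - z) = z - 1 by ring.
have e2 (z : R) : - (1 - z - 1) = z by ring.
by rewrite !e1 !e2; apply; [lra|rewrite gx0|lra].
Qed.

(** The difference [g x - g (x - 1)] is negative at [l] and positive at
    [r + 1], so it vanishes in between. *)
Lemma bowl_shift_exists g l r :
  bowl g l r -> continuous g -> exists x, g x = g (x - 1).
Proof.
move=> bg cg; pose h x := g x - g (x - 1).
have hl : h l < 0.
  by rewrite subr_lt0 (bowl_dec _ _ _ bg)//; lra.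
have hr : 0 < h (r + 1).
  by rewrite /h addrK subr_gt0 (bowl_inc _ _ _ bg)//; lra.
have lr := bowl_le _ _ _ bg.
have [|||x _ hx] := @IVT R h l (r + 1) 0.
- lra.
- apply: continuous_subspaceT => x; apply: cvgB; first exact: cg.
  apply: (@continuous_comp _ _ _ (fun x => x - 1) g); last exact: cg.
  by apply: cvgB; [exact: cvg_id|exact: cvg_cst].
- by rewrite ge_min le_max (ltW hl) (ltW hr) orbT.
by exists x; apply/eqP; rewrite -subr_eq0; apply/eqP.
Qed.

End Bowls.

(** * Convex hulls, the unit sphere and continuity *)

Section Preliminaries.
Context {R : realType} {V : normedModType R}.
Implicit Types (A : set V) (u v z : V) (t : R).

Lemma convex_setP A : convex_set A <->
  forall u v t, A u -> A v -> 0 <= t <= 1 -> A (affine_comb u v t).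
Proof.
split=> [cA u v t Au Av /andP[t0 t1]|cA u v t].
  by have := cA v u (Itv01 t0 t1) (mem_set Av) (mem_set Au); rewrite inE.
rewrite !inE => Au Av; apply: (cA v u t%:num) => //.
by apply/andP; split; [exact: ge0|exact: le1].
Qed.

Lemma convex_hull_comb A u v t :
  A u -> A v -> 0 <= t <= 1 -> convex_hull A (affine_comb u v t).
Proof.
move=> Au Av t01 C [cC AC].
by move/convex_setP: cC; apply => //; exact: AC.
Qed.

Lemma convex_hull_min A C : convex_set C -> A `<=` C -> convex_hull A `<=` C.
Proof. by move=> cC AC; exact: smallest_sub. Qed.

Lemma bd_unit_ball : bd (unit_ball V) = [set v | `|v| = 1].
Proof.
have -> : unit_ball V = closed_ball (0 : V) 1.
  by rewrite closed_ballE//; apply/seteqP; split => v;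
     rewrite /unit_ball /closed_ball_ /= sub0r normrN.
rewrite /bd interior_closed_ballE// -(closure_id _).1; last first.
  exact: closed_ball_closed.
rewrite closed_ballE// -ball_normE; apply/seteqP; split => v /=;
  rewrite /closed_ball_ /ball_ /= sub0r normrN.
- by move=> [v1 /negP]; rewrite -leNgt => v1'; apply: le_anti; rewrite v1 v1'.
- by move=> ->; rewrite ltxx.
Qed.

Lemma lipschitz_continuous (f : V -> R) (k : R) :
  (forall u v, `|f u - f v| <= k * `|u - v|) -> continuous f.
Proof.
move=> fk u; apply/cvgrPdist_lt => e e0.
have k0 : 0 < `|k| + 1 by rewrite ltr_wpDl.
near=> v; apply: (le_lt_trans (fk u v)).
apply: (@le_lt_trans _ _ ((`|k| + 1) * `|u - v|)).
  by rewrite ler_wpM2r//; have := ler_norm k; lra.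
rewrite -ltr_pdivlMl//; near: v; apply: cvgr_dist_lt => //.
by rewrite mulr_gt0 ?invr_gt0.
Unshelve. all: by end_near. Qed.

Lemma open_lt_continuous (f g : V -> R) :
  continuous f -> continuous g -> open [set z | f z < g z].
Proof.
move=> cf cg.
have -> : [set z | f z < g z] = (fun z => f z - g z) @^-1` [set x | x < 0].
  by apply/seteqP; split => z /=; rewrite subr_lt0.
apply: open_comp; last exact: open_lt.
by move=> z _; apply: cvgB; [exact: cf|exact: cg].
Qed.

End Preliminaries.

(** * Coordinates adapted to a face of the unit ball *)

Section Chart.
Context {R : realType} {V : normedModType R}.
Context (p d a : V) (w h : R) (psi : {scalar V}).
(* [h] is the maximum of [psi] on the unit ball, and the face where it is
   attained is the segment from [a] to [a + w d]. *)
Context (d_neq0 : d != 0) (w_gt0 : 0 < w) (h_gt0 : 0 < h).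
Context (psi_a : psi a = h).
Context (psi_ker : forall v, psi v = 0 <-> exists c, v = c *: d).
Context (psi_le : forall v, psi v <= h * `|v|).
Context (face : forall x, `|x *: d + a| = 1 <-> 0 <= x <= w).
Implicit Types (x y t : R) (z : V).

Definition chart x y : V := p + (x *: d + y *: a).

Definition coord_y z : R := psi (z - p) / h.

Lemma psi_d : psi d = 0.
Proof. by apply/psi_ker; exists 1; rewrite scale1r. Qed.

Lemma coord_x_exists z : exists x, z = chart x (coord_y z).
Proof.
have /psi_ker[x zE] : psi (z - p - coord_y z *: a) = 0.
  by rewrite linearB linearZ/= psi_a /coord_y divfK ?subrr// gt_eqF.
exists x; rewrite /chart -zE.
by rewrite subrK addrC subrK.
Qed.

Definition coord_x z : R := sval (cid (coord_x_exists z)).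

Lemma chart_coord z : chart (coord_x z) (coord_y z) = z.
Proof. by rewrite /coord_x; case: cid => /= x <-. Qed.

Lemma coord_y_chart x y : coord_y (chart x y) = y.
Proof.
rewrite /coord_y /chart addrC addKr linearD !linearZ/= psi_d psi_a mulr0 add0r.
by rewrite mulfK// gt_eqF.
Qed.

Lemma coord_x_chart x y : coord_x (chart x y) = x.
Proof.
have := chart_coord (chart x y); rewrite coord_y_chart /chart.
move=> /addrI/addIr/eqP; rewrite -subr_eq0 -scalerBl scaler_eq0 subr_eq0.
by rewrite (negPf d_neq0) orbF => /eqP.
Qed.

Lemma chart_comb x y x' y' t : affine_comb (chart x y) (chart x' y') t =
  chart (t * x' + (1 - t) * x) (t * y' + (1 - t) * y).
Proof.
have -> : chart (t * x' + (1 - t) * x) (t * y' + (1 - t) * y) =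
   (t *: p + (1 - t) *: p) +
   (t *: (x' *: d + y' *: a) + (1 - t) *: (x *: d + y *: a)).
  rewrite -[t *: p + _]scalerDl subrKC scale1r /chart !scalerDr !scalerA.
  by rewrite !scalerDl addrACA.
by rewrite /affine_comb /chart !scalerDr addrACA.
Qed.

Lemma affine_comb_coord z z' t : affine_comb z z' t =
  chart (t * coord_x z' + (1 - t) * coord_x z)
        (t * coord_y z' + (1 - t) * coord_y z).
Proof. by rewrite -chart_comb !chart_coord. Qed.

(** Boundedness on the unit ball is what makes [psi], and with it both
    coordinates, continuous for the given norm. *)
Lemma psi_norm v : `|psi v| <= h * `|v|.
Proof.
by rewrite ler_norml psi_le andbT lerNl -linearN -[`|v|]normrN psi_le.
Qed.

Lemma coord_yB z z' : coord_y z - coord_y z' = psi (z - z') / h.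
Proof. by rewrite /coord_y -mulrBl -linearB opprB addrA subrK. Qed.

Lemma coord_y_lipschitz z z' : `|coord_y z - coord_y z'| <= `|z - z'|.
Proof.
rewrite coord_yB normrM normfV (gtr0_norm h_gt0) ler_pdivrMr// mulrC.
exact: psi_norm.
Qed.

Lemma coord_y_continuous : continuous coord_y.
Proof.
apply: (@lipschitz_continuous _ _ _ 1) => z z'.
by rewrite mul1r coord_y_lipschitz.
Qed.

Lemma coord_x_continuous : continuous coord_x.
Proof.
apply: (@lipschitz_continuous _ _ _ ((1 + `|a|) / `|d|)) => z z'.
have dE : (coord_x z - coord_x z') *: d =
   (z - z') - (coord_y z - coord_y z') *: a.
  rewrite -[in X in _ = X - _](chart_coord z).
  rewrite -[in X in _ = X - _](chart_coord z') /chart !scalerBl.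
  by rewrite opprD addrACA subrr add0r opprD addrACA addrK.
rewrite mulrAC ler_pdivlMr ?normr_gt0// -normrZ dE.
apply: (le_trans (ler_normB _ _)); rewrite normrZ mulrDl mul1r lerD2l mulrC.
by rewrite ler_wpM2l// coord_y_lipschitz.
Qed.

(** * The distance to p along parallels to the line pq *)

Definition slice y x : R := `|x *: d + y *: a|.

Lemma slice_convex y x x' t : 0 <= t <= 1 ->
  slice y (t * x + (1 - t) * x') <= t * slice y x + (1 - t) * slice y x'.
Proof.
move=> /andP[t0 t1]; have t1' : 0 <= 1 - t by lra.
have -> : t * slice y x = `|t *: (x *: d + y *: a)|.
  by rewrite normrZ ger0_norm.
have -> : (1 - t) * slice y x' = `|(1 - t) *: (x' *: d + y *: a)|.
  by rewrite normrZ ger0_norm.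
rewrite /slice.
apply: le_trans (ler_normD _ _).
by rewrite !scalerDr addrACA !scalerA -!scalerDl subrKC scale1r.
Qed.

Lemma slice_ge y x : y <= slice y x.
Proof.
rewrite -(ler_pM2l h_gt0); apply: le_trans (psi_le _).
by rewrite linearD !linearZ/= psi_d psi_a mulr0 add0r mulrC.
Qed.

(** For [y > 0], scaling by [1/y] moves the parallel at height [y] to the
    supporting line of the ball, where the points of norm [1] form the face. *)
Lemma slice_min y x : 0 <= y -> slice y x = y <-> 0 <= x <= w * y.
Proof.
rewrite le_eqVlt => /predU1P[<-|y0].
  rewrite /slice scale0r addr0 mulr0 -eq_le eq_sym; split=> [/eqP|/eqP->].
    by rewrite normr_eq0 scaler_eq0 (negPf d_neq0) orbF.
  by rewrite scale0r normr0.
have -> : slice y x = y * `|(x / y) *: d + a|.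
  rewrite -[X in _ = X * _](gtr0_norm y0) -normrZ scalerDr scalerA.
  rewrite (mulrC y) divfK//.
  exact: lt0r_neq0.
have xyE : (0 <= x / y <= w) = (0 <= x <= w * y).
  by rewrite pmulr_lge0 ?invr_gt0// ler_pdivrMr.
rewrite -xyE -face; split=> [yE|->]; last by rewrite mulr1.
by apply: (mulfI (lt0r_neq0 y0)); rewrite mulr1.
Qed.

Lemma slice_bowl_ge0 y : 0 <= y -> bowl (slice y) 0 (w * y).
Proof.
move=> y0; apply: (@convex_bowl _ _ _ _ y); first exact: slice_convex.
- by rewrite mulr_ge0// ltW.
- exact: slice_ge.
- by move=> x; exact: slice_min.
Qed.

Lemma sliceN y x : slice y (- x) = slice (- y) x.
Proof. by rewrite /slice !scaleNr -normrN opprD opprK. Qed.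

Lemma slice_bowl_le0 y : y <= 0 -> bowl (slice y) (w * y) 0.
Proof.
move=> y0; have := bowl_opp _ _ _ (slice_bowl_ge0 (- y) _).
rewrite oppr0 mulrN opprK oppr_ge0 => /(_ y0).
by congr bowl; apply/funext => x; rewrite sliceN opprK.
Qed.

Lemma slice_bowl y : exists l r, bowl (slice y) l r /\ r - l = w * `|y|.
Proof.
have [y0|/ltW y0] := leP 0 y.
  by exists 0, (w * y); split; [exact: slice_bowl_ge0|rewrite subr0 ger0_norm].
exists (w * y), 0; split; first exact: slice_bowl_le0.
by rewrite sub0r ler0_norm// mulrN.
Qed.

Lemma slice_continuous y : continuous (slice y).
Proof.
move=> x; apply: (@continuous_comp _ _ _ (fun x => x *: d + y *: a) Num.norm);
  last exact: norm_continuous.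
by apply: cvgD; [apply: cvgZr_tmp; exact: cvg_id|exact: cvg_cst].
Qed.

Lemma slice_continuous_height x : continuous (slice ^~ x).
Proof.
move=> y; apply: (@continuous_comp _ _ _ (fun y => x *: d + y *: a) Num.norm);
  last exact: norm_continuous.
by apply: cvgD; [exact: cvg_cst|apply: cvgZr_tmp; exact: cvg_id].
Qed.

Lemma bis_chart x y :
  bis p (p + d) (chart x y) <-> slice y x = slice y (x - 1).
Proof.
rewrite /bis /slice /chart /= addrC addKr scalerBl scale1r.
by rewrite opprD addrA [p + _]addrC addrK addrAC.
Qed.

(** The disjunctions encode [min 0 (w y) < x < max 1 (1 + w y)]: the sign of the
    height [y] decides which end of the flat part is at abscissa [0]. *)
Definition strip : set V := [set z |
  (0 < coord_x z \/ w * coord_y z < coord_x z) /\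
  (coord_x z < 1 \/ coord_x z < 1 + w * coord_y z)].

Lemma strip_open : open strip.
Proof.
have cwy : continuous (fun z => w * coord_y z).
  by move=> z; apply: cvgMl_tmp; exact: coord_y_continuous.
have c1wy : continuous (fun z => 1 + w * coord_y z).
  by move=> z; apply: cvgD; [exact: cvg_cst|exact: cwy].
have cx := coord_x_continuous.
have c0 (c : R) : continuous (fun _ : V => c) by move=> z; exact: cvg_cst.
by apply: openI; apply: openU; exact: open_lt_continuous.
Qed.

Lemma bis_strip : bis p (p + d) `<=` strip.
Proof.
move=> z; rewrite -(chart_coord z).
move: (coord_x z) (coord_y z) => x y /bis_chart gx.
rewrite /strip /= coord_x_chart coord_y_chart.
have [y0|/ltW y0] := leP 0 y.
  have := bowl_shift_bounds _ _ _ _ (slice_bowl_ge0 _ y0) gx.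
  by move=> /andP[? ?]; split; [left|right; rewrite addrC].
have := bowl_shift_bounds _ _ _ _ (slice_bowl_le0 _ y0) gx.
by rewrite add0r => /andP[? ?]; split; [right|left].
Qed.

(** * The bisector on each parallel *)

Lemma bis_upper x y : 1 <= w * y ->
  bis p (p + d) (chart x y) <-> 1 <= x <= w * y.
Proof.
move=> wy1; have y0 : 0 <= y by rewrite -(pmulr_rge0 _ w_gt0); lra.
by rewrite bis_chart (bowl_shift_wide _ _ _ _ (slice_bowl_ge0 _ y0)) ?add0r.
Qed.

Lemma bis_lower x y : w * y <= - 1 ->
  bis p (p + d) (chart x y) <-> w * y + 1 <= x <= 0.
Proof.
move=> wy1; have y0 : y <= 0 by rewrite -(pmulr_rle0 _ w_gt0); lra.
by rewrite bis_chart (bowl_shift_wide _ _ _ _ (slice_bowl_le0 _ y0))//; lra.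
Qed.

Lemma bis_abscissa_exists y : exists x, slice y x = slice y (x - 1).
Proof.
have [l [r [bg _]]] := slice_bowl y.
exact: bowl_shift_exists bg (@slice_continuous y).
Qed.

Definition bis_abscissa y : R := sval (cid (bis_abscissa_exists y)).

Lemma slice_bis_abscissa y :
  slice y (bis_abscissa y) = slice y (bis_abscissa y - 1).
Proof. by rewrite /bis_abscissa; case: cid. Qed.

Lemma slice_lt_left x y :
  w * `|y| <= 1 -> x < bis_abscissa y -> slice y x < slice y (x - 1).
Proof.
move=> wy1; have [l [r [bg rl]]] := slice_bowl y.
by apply: (bowl_shift_left _ _ _ _ _ bg _ (slice_bis_abscissa y)); lra.
Qed.

Lemma slice_gt_right x y :
  w * `|y| <= 1 -> bis_abscissa y < x -> slice y (x - 1) < slice y x.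
Proof.
move=> wy1; have [l [r [bg rl]]] := slice_bowl y.
by apply: (bowl_shift_right _ _ _ _ _ bg _ (slice_bis_abscissa y)); lra.
Qed.

Lemma bis_abscissa_unique x y :
  w * `|y| <= 1 -> slice y x = slice y (x - 1) -> x = bis_abscissa y.
Proof.
move=> wy1 gx; apply/eqP; rewrite eq_le !leNgt; apply/andP; split; apply/negP.
  by move=> /(slice_gt_right _ _ wy1); rewrite gx ltxx.
by move=> /(slice_lt_left _ _ wy1); rewrite gx ltxx.
Qed.

(** Just left and just right of the solution at height [y] the two distances
    compare strictly, in opposite senses.  Both comparisons persist at nearby
    heights, where they enclose the solution. *)
Lemma bis_abscissa_continuous y : w * `|y| <= 1 ->
  bis_abscissa @ within [set y | w * `|y| <= 1] (nbhs y) --> bis_abscissa y.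
Proof.
move=> wy1; apply/cvgrPdist_lt => e e0; rewrite near_withinE.
have slice_lt u v : slice y u < slice y v ->
    \forall y' \near y, slice y' u < slice y' v.
  move=> uv; near=> y'; rewrite -subr_gt0; near: y'.
  apply: (@cvgr_gt _ _ _ _ (fun y' => slice y' v - slice y' u)
    (slice y v - slice y u)); last by rewrite subr_gt0.
  by apply: cvgB; exact: slice_continuous_height.
have below : \forall y' \near y,
    slice y' (bis_abscissa y - e) < slice y' (bis_abscissa y - e - 1).
  by apply: slice_lt; apply: slice_lt_left => //; lra.
have above : \forall y' \near y,
    slice y' (bis_abscissa y + e - 1) < slice y' (bis_abscissa y + e).
  by apply: slice_lt; apply: slice_gt_right => //; lra.
near=> y' => /= wy'.
have lo : slice y' (bis_abscissa y - e) < slice y' (bis_abscissa y - e - 1).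
  by near: y'.
have hi : slice y' (bis_abscissa y + e - 1) < slice y' (bis_abscissa y + e).
  by near: y'.
rewrite ltr_norml; apply/andP; split; rewrite ltNge; apply/negP => le.
- have : bis_abscissa y + e <= bis_abscissa y' by lra.
  rewrite le_eqVlt => /predU1P[E|/(slice_lt_left _ _ wy')].
    by move: hi; rewrite E -slice_bis_abscissa ltxx.
  by move=> /(lt_trans hi); rewrite ltxx.
- have : bis_abscissa y' <= bis_abscissa y - e by lra.
  rewrite le_eqVlt => /predU1P[E|/(slice_gt_right _ _ wy')].
    by move: lo; rewrite -E -slice_bis_abscissa ltxx.
  by move=> /(lt_trans lo); rewrite ltxx.
Unshelve. all: by end_near. Qed.

(** * The curve and the two wedges *)

(** Parametrizes by the unit interval the heights [w |y| <= 1], for which the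
    flat part has length at most [1] and the parallel meets the bisector once. *)
Definition curve_height t : R := (2 * t - 1) / w.

Lemma w_curve_height t : w * curve_height t = 2 * t - 1.
Proof. by rewrite /curve_height mulrC divfK// gt_eqF. Qed.

Lemma curve_height_itv t :
  0 <= t <= 1 -> w * `|curve_height t| <= 1.
Proof.
move=> t01; rewrite -{1}(gtr0_norm w_gt0) -normrM w_curve_height.
by rewrite ler_norml; lra.
Qed.

Definition curve t : V :=
  chart (bis_abscissa (curve_height t)) (curve_height t).

Definition curve_param z : R := (w * coord_y z + 1) / 2.

Lemma curveK t : curve_param (curve t) = t.
Proof.
by rewrite /curve_param /curve coord_y_chart w_curve_height; field.
Qed.

Lemma curve_continuous : {within `[0, 1], continuous curve}.
Proof.
apply/subspace_continuousP => t /= t01.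
have ch : {for t, continuous curve_height}.
  apply: cvgMr_tmp.
  by apply: cvgB; [apply: cvgMl_tmp; exact: cvg_id|exact: cvg_cst].
have ht : w * `|curve_height t| <= 1.
  by apply: curve_height_itv; move: t01; rewrite in_itv.
have cm : bis_abscissa \o curve_height @ within `[0, 1] (nbhs t) -->
    bis_abscissa (curve_height t).
  apply: cvg_comp; last exact: (bis_abscissa_continuous _ ht).
  move=> P HP.
  suff : \forall s \near t, s \in `[0, 1] -> P (curve_height s) by [].
  have : \forall s \near t, w * `|curve_height s| <= 1 -> P (curve_height s).
    exact: ch HP.
  apply: filterS => s Ps s01; apply: Ps.
  by apply: curve_height_itv; move: s01; rewrite /= in_itv.
rewrite /curve /chart; apply: cvgD; first exact: cvg_cst.
apply: cvgD; apply: cvgZr_tmp; first exact: cm.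
exact: cvg_within_filter.
Qed.

Lemma curve_homeomorphism :
  homeomorphism_between (`[0, 1] : set R) (curve @` `[0, 1]) curve.
Proof.
split; last 1 first.
- exists curve_param; last by move=> t _; exact: curveK.
  apply: continuous_subspaceT => z; apply: cvgMr_tmp; apply: cvgD.
    by apply: cvgMl_tmp; exact: coord_y_continuous.
  exact: cvg_cst.
- split; [by move=> t t01; exists t| |by []].
  exact: (can_in_inj (fun t _ => curveK t)).
- exact: curve_continuous.
Qed.

Lemma curve0 : curve 0 = chart 0 (- w^-1).
Proof.
have hE : curve_height 0 = - w^-1 by rewrite /curve_height mulr0 sub0r mulN1r.
have wE : w * - w^-1 = -1 by rewrite mulrN divff// gt_eqF.
rewrite /curve hE; congr chart; apply/esym/bis_abscissa_unique.
  by rewrite normrN gtr0_norm ?invr_gt0// divff// gt_eqF.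
by apply/bis_chart/bis_lower; rewrite wE; lra.
Qed.

Lemma curve1 : curve 1 = chart 1 w^-1.
Proof.
have hE : curve_height 1 = w^-1.
  by rewrite /curve_height mulr1 -[2]/(1 + 1) addrK mul1r.
have wE : w / w = 1 by rewrite divff// gt_eqF.
rewrite /curve hE; congr chart; apply/esym/bis_abscissa_unique.
  by rewrite gtr0_norm ?invr_gt0// wE.
by apply/bis_chart/bis_upper; rewrite wE; lra.
Qed.

(** A point of the wedge is [st] plus a nonnegative combination of the
    directions of the two rays; doubling either coefficient and dropping the other one gives
    two points of the rays of which it is the midpoint. *)
Lemma upper_wedge :
  convex_hull (opp_ray (chart 1 w^-1) (chart 0 0) `|`
               opp_ray (chart 1 w^-1) (chart 1 0)) =
  [set z | 1 <= coord_x z <= w * coord_y z].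
Proof.
have wE : w / w = 1 by rewrite divff// gt_eqF.
apply/seteqP; split.
  apply: convex_hull_min.
    apply/convex_setP => u v t /=; rewrite affine_comb_coord.
    rewrite coord_x_chart coord_y_chart => ? ? ?; nra.
  move=> z [] [l /= l0 <-];
    by rewrite chart_comb /= coord_x_chart coord_y_chart; nra.
move=> z /= xy; rewrite -(chart_coord z).
move: (coord_x z) (coord_y z) xy => x y xy.
pose k := - 2 * (x - 1); pose l := - 2 * (w * y - x).
have -> : chart x y =
    affine_comb (affine_comb (chart 1 w^-1) (chart 0 0) k)
                (affine_comb (chart 1 w^-1) (chart 1 0) l) 2^-1.
  rewrite !chart_comb; congr chart; rewrite /k /l; field => //.
  exact: lt0r_neq0.
apply: convex_hull_comb; [left|right|lra].
  by exists k; rewrite //= /k; lra.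
by exists l; rewrite //= /l; lra.
Qed.

(** Same midpoint argument as for [upper_wedge], with apex [sb]. *)
Lemma lower_wedge :
  convex_hull (opp_ray (chart 0 (- w^-1)) (chart 0 0) `|`
               opp_ray (chart 0 (- w^-1)) (chart 1 0)) =
  [set z | w * coord_y z + 1 <= coord_x z <= 0].
Proof.
have wE : w / w = 1 by rewrite divff// gt_eqF.
apply/seteqP; split.
  apply: convex_hull_min.
    apply/convex_setP => u v t /=; rewrite affine_comb_coord.
    rewrite coord_x_chart coord_y_chart => ? ? ?; nra.
  move=> z [] [l /= l0 <-];
    by rewrite chart_comb /= coord_x_chart coord_y_chart; nra.
move=> z /= xy; rewrite -(chart_coord z).
move: (coord_x z) (coord_y z) xy => x y xy.
pose k := 2 * (w * y + 1 - x); pose l := 2 * x.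
have -> : chart x y =
    affine_comb (affine_comb (chart 0 (- w^-1)) (chart 0 0) k)
                (affine_comb (chart 0 (- w^-1)) (chart 1 0) l) 2^-1.
  rewrite !chart_comb; congr chart; rewrite /k /l; field => //.
  exact: lt0r_neq0.
apply: convex_hull_comb; [left|right|lra].
  by exists k; rewrite //= /k; lra.
by exists l; rewrite //= /l; lra.
Qed.

(** At each height the strip is the open segment joining the points of the two
    rays with the same parameter [|y|], so every point of it is a convex
    combination of just these two. *)
Lemma strip_hulls : strip `<=`
  convex_hull (ray (chart 0 0) (chart 0 1) `|`
               ray (chart 1 0) (chart (1 + w) 1)) `|`
  convex_hull (ray (chart 0 0) (chart (- w) (- 1)) `|`
               ray (chart 1 0) (chart 1 (- 1))).
Proof.
move=> z [xl xr]; rewrite -(chart_coord z).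
move: (coord_x z) (coord_y z) xl xr => x y xl xr.
have [y0|y0] := leP 0 y; [left|right].
- have wy : 0 <= w * y by rewrite mulr_ge0// ltW.
  have D : 0 < 1 + w * y by lra.
  have -> : chart x y = affine_comb (affine_comb (chart 0 0) (chart 0 1) y)
      (affine_comb (chart 1 0) (chart (1 + w) 1) y) (x / (1 + w * y)).
    by rewrite !chart_comb; congr chart; field; rewrite lt0r_neq0.
  apply: convex_hull_comb; [by left; exists y|by right; exists y|].
  by rewrite ler_pdivlMr// ler_pdivrMr//; case: xl xr => ? [] ?; lra.
- have wy : 0 < w * - y by rewrite mulr_gt0// oppr_gt0.
  have D : 0 < 1 - w * y by lra.
  have -> : chart x y =
      affine_comb (affine_comb (chart 0 0) (chart (- w) (- 1)) (- y))
        (affine_comb (chart 1 0) (chart 1 (- 1)) (- y))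
        ((x - w * y) / (1 - w * y)).
    by rewrite !chart_comb; congr chart; field; rewrite lt0r_neq0.
  have yn : 0 <= - y by lra.
  apply: convex_hull_comb; [by left; exists (- y)|by right; exists (- y)|].
  by rewrite ler_pdivlMr// ler_pdivrMr//; case: xl xr => ? [] ?; lra.
Qed.

Lemma bis_interior : interior (bis p (p + d)) !=set0.
Proof.
pose U := [set z : V | 1 < coord_x z] `&` [set z | coord_x z < w * coord_y z].
exists (chart 2 (3 / w)).
have UB : U `<=` bis p (p + d).
  move=> z [/= x1 xy]; rewrite -(chart_coord z).
  by apply/bis_upper; [lra|apply/andP; split; lra].
apply: (interiorS UB); apply: open_nbhs_nbhs; split.
  apply: openI.
    apply: open_lt_continuous; first exact: cst_continuous.
    exact: coord_x_continuous.
  apply: open_lt_continuous; first exact: coord_x_continuous.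
  by move=> z; apply: cvgMl_tmp; exact: coord_y_continuous.
rewrite /U /= coord_x_chart coord_y_chart mulrC divfK ?lt0r_neq0//.
by split; lra.
Qed.

Lemma bis_decomposition : bis p (p + d) =
  curve @` `[0, 1] `|` [set z | 1 <= coord_x z <= w * coord_y z]
                   `|` [set z | w * coord_y z + 1 <= coord_x z <= 0].
Proof.
apply/seteqP; split => z.
  rewrite -{1}(chart_coord z).
  have [wy1 /bis_upper|wy1] := leP 1 (w * coord_y z).
    by move=> /(_ wy1) ?; left; right.
  have [wy2 /bis_lower|wy2] := leP (w * coord_y z) (- 1).
    by move=> /(_ wy2) ?; right.
  move=> /bis_chart/bis_abscissa_unique xE; left; left.
  exists (curve_param z).
    by rewrite /curve_param /= in_itv/=; lra.
  have hE : curve_height (curve_param z) = coord_y z.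
    by rewrite /curve_height /curve_param; field; exact: lt0r_neq0.
  rewrite /curve hE -xE ?chart_coord//.
  by rewrite -{1}(gtr0_norm w_gt0) -normrM ler_norml; lra.
move=> [[[t _ <-]|/= xy]|/= xy].
- by apply/bis_chart; exact: slice_bis_abscissa.
- by rewrite -(chart_coord z); apply/bis_upper; [lra|].
- by rewrite -(chart_coord z); apply/bis_lower; [lra|].
Qed.

Theorem bis_structure :
  [/\ interior (bis p (p + d)) !=set0,
      bis p (p + d) `<=` interior
        (convex_hull (ray (chart 0 0) (chart 0 1) `|`
                      ray (chart 1 0) (chart (1 + w) 1)) `|`
         convex_hull (ray (chart 0 0) (chart (- w) (- 1)) `|`
                      ray (chart 1 0) (chart 1 (- 1))))
    & exists B1 : set V,
        bis p (p + d) = B1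
          `|` convex_hull (opp_ray (chart 1 w^-1) (chart 0 0) `|`
                           opp_ray (chart 1 w^-1) (chart 1 0))
          `|` convex_hull (opp_ray (chart 0 (- w^-1)) (chart 0 0) `|`
                           opp_ray (chart 0 (- w^-1)) (chart 1 0)) /\
        exists f : R -> V,
          [/\ homeomorphism_between (`[0, 1] : set R) B1 f,
              f 0 = chart 0 (- w^-1) & f 1 = chart 1 w^-1]].
Proof.
split; first exact: bis_interior.
  move=> z /bis_strip zs; apply: (interiorS strip_hulls).
  by apply: open_nbhs_nbhs; split => //; exact: strip_open.
exists (curve @` `[0, 1]); rewrite upper_wedge lower_wedge; split.
  exact: bis_decomposition.
exists curve; split; [exact: curve_homeomorphism|exact: curve0|exact: curve1].
Qed.

End Chart.

(** * Supporting lines and oriented faces *)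

Section SupportingLines.
Context {R : realType} {V : normedModType R}.
Implicit Types (p q a b d u v x y z : V) (S : set V) (c h : R).

Lemma seg_translate u0 x y :
  translate u0 (seg x y) = seg (u0 + x) (u0 + y) :> set V.
Proof.
have E t : u0 + affine_comb x y t = affine_comb (u0 + x) (u0 + y) t.
  by rewrite /affine_comb !scalerDr addrACA -scalerDl subrKC scale1r.
apply/seteqP; split => [_ [_ [t t01 <-] <-]|_ [t t01 <-]].
  by exists t.
by exists (affine_comb x y t) => //; exists t.
Qed.

Lemma seg_opp x y : [set - z | z in seg x y] = seg (- y) (- x).
Proof.
have E t : - affine_comb x y t = affine_comb (- y) (- x) (1 - t).
  by rewrite /affine_comb opprB subrKC !scalerN opprD addrC.
apply/seteqP; split => [_ [_ [t /= t01 <-] <-]|_ [t /= t01 <-]].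
  by exists (1 - t) => //=; lra.
exists (affine_comb x y (1 - t)); first by exists (1 - t) => //=; lra.
by rewrite E subKr.
Qed.

Lemma translateK u0 : cancel (translate u0) (translate (- u0) : set V -> set V).
Proof.
move=> A; apply/seteqP; split => [_ [_ [z Az <-] <-]|z Az].
  by rewrite addKr.
by exists (u0 + z); [exists z|rewrite addKr].
Qed.

Lemma left_right_seg_translate d u0 S x y :
  left_right_seg d (translate u0 S) x y ->
  left_right_seg d S (x - u0) (y - u0).
Proof.
move=> [SE [k k0 yx]]; split.
  by rewrite -[S](translateK u0) SE seg_translate ![- u0 + _]addrC.
by exists k => //; rewrite opprB addrA subrK.
Qed.

Lemma left_right_seg_opp d S x y :
  left_right_seg d [set - z | z in S] x y -> left_right_seg d S (- y) (- x).
Proof.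
move=> [SE [k k0 yx]]; split; last by exists k => //; rewrite opprK addrC.
rewrite -seg_opp -SE; apply/seteqP; split => z.
  by move=> Sz; exists (- z); [exists z|rewrite opprK].
by move=> [_ [u Su <-] <-]; rewrite opprK.
Qed.

(** The orientation fixes the sign, so that a segment is described by its left
    end point and one length [w >= 0], measured in units of [d]. *)
Lemma left_right_segE d S x y : left_right_seg d S x y ->
  exists2 w : R, 0 <= w & y = x + w *: d /\
    forall z, S z <-> exists2 t, 0 <= t <= w & z = x + t *: d.
Proof.
move=> [-> [w w0 yx]]; have yE : y = x + w *: d by rewrite -yx subrKC.
exists w => //; split=> // z.
have E t : affine_comb x y t = x + (t * w) *: d.
  rewrite /affine_comb yE scalerDr scalerA addrAC -scalerDl subrKC.
  by rewrite scale1r.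
split=> [[t /= t01 <-]|[t t0w ->]].
  by exists (t * w); rewrite ?E//; nra.
have [w_eq0|w_neq0] := eqVneq w 0.
  by exists 0; rewrite /= ?E ?mul0r; [lra|congr (_ + _ *: _); lra].
exists (t / w); rewrite ?E ?divfK//=.
have w_gt0 : 0 < w by rewrite lt_neqAle eq_sym w_neq0.
by rewrite divr_ge0 ?ler_pdivrMr//; lra.
Qed.

(** Each end point lies in the other segment, to the right of its left end
    point: the offsets [s] and [s'] are nonnegative and cancel. *)
Lemma left_right_seg_unique d S x y x' y' : d != 0 ->
  left_right_seg d S x y -> left_right_seg d S x' y' -> x = x' /\ y = y'.
Proof.
move=> d0 /left_right_segE[w w0 [-> SE]] /left_right_segE[w' w'0 [-> SE']].
have left_mem u (e : R) : 0 <= e -> exists2 t, 0 <= t <= e & u = u + t *: d.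
  by move=> e0; exists 0; rewrite ?lexx// scale0r addr0.
have right_mem u (e : R) : 0 <= e ->
    exists2 t, 0 <= t <= e & u + e *: d = u + t *: d.
  by move=> e0; exists e; rewrite ?lexx ?e0.
have [s s0 xE] := (SE' x).1 ((SE x).2 (left_mem _ _ w0)).
have [s' s'0 x'E] := (SE x').1 ((SE' x').2 (left_mem _ _ w'0)).
have [r r0 yE] := (SE' _).1 ((SE _).2 (right_mem x _ w0)).
have [r' r'0 y'E] := (SE _).1 ((SE' _).2 (right_mem x' _ w'0)).
have dI (e e' : R) u : u + e *: d = u + e' *: d -> e = e'.
  move=> /addrI/eqP; rewrite -subr_eq0 -scalerBl scaler_eq0 (negPf d0) orbF.
  by rewrite subr_eq0 => /eqP.
have ss : s + s' = 0.
  by apply: (dI _ _ x'); rewrite scale0r addr0 scalerDl addrA -xE -x'E.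
have s_eq0 : s = 0 by lra.
have xx : x = x' by rewrite xE s_eq0 scale0r addr0.
split=> //; move: yE y'E; rewrite xx => /dI wE /dI w'E.
by congr (_ + _ *: d); lra.
Qed.

(** The kernel of the functional [phi] defining [L] is the direction of [L],
    spanned by [q - p], on which [psi] vanishes too.  So [psi] is a
    multiple of [phi], and a positive one because [L] lies above [p]. *)
Lemma common_supportE (psi : {scalar V}) p q L :
  psi (p - q) = 0 -> common_support psi p q L ->
  exists h, [/\ 0 < h,
    forall v, psi v = 0 <-> exists c, v = c *: (q - p),
    forall v, psi v <= h * `|v|,
    exists2 v, `|v| <= 1 & psi v = h
  & L = [set z | psi (z - p) = h]].
Proof.
move=> psipq [[phi [c [[v0 phi_v0] LE Lsub [z0 [Lz0 pBz0]]]]] _ [b Lpq] above].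
have psi_d : psi (q - p) = 0 by rewrite -opprB linearN/= psipq oppr0.
have phi_ker v : phi v = 0 -> exists c, v = c *: (q - p).
  move=> phiv.
  have : L (z0 + v) by move: Lz0; rewrite LE /= linearD /= phiv addr0.
  move: Lz0; rewrite Lpq => -[_ [l _ <-] z0E] [_ [l' _ <-] zE].
  exists (l' - l); move: zE; rewrite -z0E -addrA => /addrI zE.
  have -> : v = affine_comb p q l' - affine_comb p q l.
    by rewrite zE addrAC subrr add0r.
  rewrite /affine_comb opprD addrACA -!scalerBl.
  have -> : 1 - l' - (1 - l) = - (l' - l) by ring.
  by rewrite scaleNr -scalerBr.
(* the ratio between the proportional functionals *)
pose k := psi v0 / phi v0.
have psiE v : psi v = k * phi v.
  have /phi_ker[e] : phi (v - (phi v / phi v0) *: v0) = 0.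
    by rewrite linearB linearZ/= divfK ?subrr//; apply/eqP.
  move=> /(congr1 psi); rewrite linearB !linearZ/= psi_d mulr0.
  move=> /eqP; rewrite scalerN subr_eq0 => /eqP ->.
  by rewrite -[_ *: _]/(phi v / phi v0 * psi v0) /k; field; apply/eqP.
clearbody k; have phip : phi p <= c.
  by apply: Lsub; exists 0; rewrite ?addr0// /unit_ball /= normr0.
have kc : 0 < k * (c - phi p).
  have := above _ Lz0; move: Lz0; rewrite LE /= => <-.
  by rewrite -subr_gt0 -!linearB/= psiE.
have k0 : 0 < k.
  rewrite ltNge; apply/negP => k0.
  by move: kc; rewrite ltNge mulr_le0_ge0 ?subr_ge0.
exists (k * (c - phi p)); split => //.
- move=> v; split=> [|[e ->]]; last by rewrite linearZ/= psi_d mulr0.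
  by rewrite psiE => /eqP; rewrite mulf_eq0 gt_eqF//= => /eqP/phi_ker.
- move=> v; have [->|v_neq0] := eqVneq v 0.
    by rewrite linear0 normr0 mulr0.
  have nv : 0 < `|v| by rewrite normr_gt0.
  rewrite psiE -mulrA ler_pM2l// -ler_pdivrMr// lerBrDl mulrC.
  have : translate p (unit_ball V) (p + `|v|^-1 *: v).
    exists (`|v|^-1 *: v) => //.
    by rewrite /unit_ball /= normrZ normfV normr_id mulVf// gt_eqF.
  by move/Lsub; rewrite /= linearD linearZ.
- case: pBz0 => v v1 z0E; exists v => //.
  move: Lz0; rewrite LE /= -z0E linearD /= => <-.
  by rewrite psiE (addrC (phi p)) addrK.
rewrite LE; apply/seteqP; split => z /=; rewrite psiE linearB/=.
  by move=> ->.
by move/(mulfI (lt0r_neq0 k0))/addIr.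
Qed.

End SupportingLines.

(** Translation from [p] to a centre [u] on the same level of [psi] preserves
    the line, which therefore cuts the same section from all these spheres. *)
Lemma support_face (R : realType) (V : normedModType R)
    (psi : V -> R) (p u : V) (c : R) :
  (forall v v' : V, psi (v - v') = psi v - psi v') -> psi u = psi p ->
  [set z | psi (z - p) = c] `&` translate u (bd (unit_ball V)) =
  translate u [set v : V | `|v| = 1 /\ psi v = c].
Proof.
move=> psiB psiu; rewrite bd_unit_ball.
have psiE (v : V) : psi (u + v - p) = psi v.
  by have := psiB (u + v) u; rewrite addrAC subrr add0r psiB psiu.
apply/seteqP; split => [z [/= zc [v v1 zE]]|_ [v [v1 vc] <-]].
  by exists v => //; split=> //; rewrite -zc -zE psiE.
by split; [rewrite /= psiE|exists v].
Qed.

Theorem theorem2p1 (R : realType) (V : normedModType R)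
    (dimV : Vector.axiom 2 V)
    (p q : V) (hpq : p <> q) (hns : ~ strict_pair p q)
    (psi : {scalar V}) (hpsi : exists v, psi v <> 0) (hpsipq : psi (p - q) = 0)
    (Ltop Lbot : set V)
    (hLtop : common_support psi p q Ltop)
    (hLbot : common_support (fun z => - psi z) p q Lbot)
    (tp tp' tq tq' bp bp' bq bq' st sb : V)
    (htp : left_right_seg (q - p)
             (Ltop `&` translate p (bd (unit_ball V))) tp tp')
    (htq : left_right_seg (q - p)
             (Ltop `&` translate q (bd (unit_ball V))) tq' tq)
    (hbp : left_right_seg (q - p)
             (Lbot `&` translate p (bd (unit_ball V))) bp bp')
    (hbq : left_right_seg (q - p)
             (Lbot `&` translate q (bd (unit_ball V))) bq' bq)
    (hst : ray p tp' `&` ray q tq' = [set st])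
    (hsb : ray p bp' `&` ray q bq' = [set sb]) :
  [/\ interior (bis p q) !=set0,
      bis p q `<=`
        interior (convex_hull (ray p tp `|` ray q tq) `|`
                  convex_hull (ray p bp `|` ray q bq))
    & exists B1 : set V,
        bis p q = B1 `|` convex_hull (opp_ray st p `|` opp_ray st q)
                     `|` convex_hull (opp_ray sb p `|` opp_ray sb q) /\
        exists f : R -> V,
          [/\ homeomorphism_between (`[0, 1] : set R) B1 f, f 0 = sb & f 1 = st]].
Proof.
pose d := q - p; have d0 : d != 0 by rewrite subr_eq0; apply/eqP => /esym.
have psi_q : psi q = psi p.
  by move/eqP: hpsipq; rewrite linearB subr_eq0 => /eqP.
have [h [h0 psi_ker psi_le [v1 v1_le psi_v1] LtopE]] :=
  common_supportE _ _ _ _ hpsipq hLtop.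
have npsipq : (\- psi) (p - q) = 0 by rewrite /= hpsipq oppr0.
have [h' [h'0 _ npsi_le [v2 v2_le psi_v2] LbotE]] :=
  common_supportE (\- psi : {scalar V}) _ _ _ npsipq hLbot.
(* the unit ball is symmetric, so the [psi]-levels of the two supporting lines
   differ from that of [p] by [h] and [- h] *)
have h'E : h' = h.
  apply: le_anti; apply/andP; split.
    rewrite -psi_v2 /= -linearN (le_trans (psi_le _))// normrN.
    by rewrite -[leRHS]mulr1 ler_pM2l.
  have := npsi_le (- v1); rewrite /= linearN opprK psi_v1 normrN.
  by move=> /le_trans; apply; rewrite -[leRHS]mulr1 ler_pM2l.
pose F := [set v : V | `|v| = 1 /\ psi v = h].
have top_face u x y : psi u = psi p ->
    left_right_seg d (Ltop `&` translate u (bd (unit_ball V))) x y ->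
    left_right_seg d F (x - u) (y - u).
  move=> psiu; rewrite LtopE support_face//; last exact: linearB.
  exact: left_right_seg_translate.
(* the bottom face is [- F], whose left end is minus the right end of [F] *)
have bottom_face u x y : psi u = psi p ->
    left_right_seg d (Lbot `&` translate u (bd (unit_ball V))) x y ->
    left_right_seg d F (u - y) (u - x).
  move=> psiu; rewrite LbotE support_face; first last.
  - by rewrite /= psiu.
  - exact: linearB.
  move=> /left_right_seg_translate.
  have -> : [set v | `|v| = 1 /\ (\- psi) v = h'] = [set - v | v in F].
    apply/seteqP; split=> [v [v_1 vh]|_ [v [v_1 vh] <-]].
      by exists (- v); rewrite ?opprK// /F /= normrN linearN -h'E.
    by rewrite /= normrN linearN opprK h'E.
  by move=> /left_right_seg_opp; rewrite !opprB.
have Fp := top_face _ _ _ erefl htp.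
pose a := tp - p.
have [w w0 [a'E FE]] := left_right_segE _ _ _ _ Fp.
have [tq'E tqE] := left_right_seg_unique _ _ _ _ _ _ d0
  (top_face _ _ _ psi_q htq) Fp.
have [bp'E bpE] := left_right_seg_unique _ _ _ _ _ _ d0
  (bottom_face _ _ _ erefl hbp) Fp.
have [bqE bq'E] := left_right_seg_unique _ _ _ _ _ _ d0
  (bottom_face _ _ _ psi_q hbq) Fp.
have psi_a : psi a = h.
  suff [] : F a by [].
  by apply/FE; exists 0; rewrite ?lexx// scale0r addr0.
have psi_d : psi d = 0 by rewrite linearB psi_q subrr.
have qE : p + d = q by rewrite subrKC.
have p_chart : chart p d a 0 0 = p by rewrite /chart !scale0r !addr0.
have q_chart : chart p d a 1 0 = q by rewrite /chart scale0r scale1r addr0.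
have tp_chart : chart p d a 0 1 = tp.
  by rewrite /chart scale0r scale1r add0r subrKC.
have tp'_chart : chart p d a w 1 = tp'.
  by rewrite /chart scale1r addrC -[RHS](subrK p) a'E (addrC a).
have tq'_chart : chart p d a 1 1 = tq'.
  by rewrite /chart !scale1r addrA qE -[RHS](subrKC q) tq'E.
have tq_chart : chart p d a (1 + w) 1 = tq.
  rewrite /chart scalerDl !scale1r -addrA (addrA p) qE (addrC _ a) -a'E -tqE.
  by rewrite subrKC.
have bp_chart : chart p d a (- w) (- 1) = bp.
  by rewrite /chart !scaleNr scale1r -opprD (addrC _ a) -a'E -bpE subKr.
have bp'_chart : chart p d a 0 (- 1) = bp'.
  by rewrite /chart scale0r add0r scaleN1r /a -bp'E subKr.
have bq'_chart : chart p d a (1 - w) (- 1) = bq'.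
  rewrite /chart scalerDl !scaleNr !scale1r -addrA (addrA p) qE -opprD.
  by rewrite (addrC _ a) -a'E -bq'E subKr.
have bq_chart : chart p d a 1 (- 1) = bq.
  by rewrite /chart scaleN1r scale1r addrA qE /a -bqE subKr.
(* if the face were a point, the rays meeting in [st] would be parallel *)
have w_gt0 : 0 < w.
  rewrite lt_neqAle w0 andbT; apply/eqP => w_eq0.
  have [] : (ray p tp' `&` ray q tq') st by rewrite hst.
  rewrite -p_chart -q_chart -tp'_chart -tq'_chart -w_eq0.
  move=> [l _ <-] [l' _]; rewrite !chart_comb /chart => /addrI.
  rewrite !(mulr0, mulr1, addr0) subrKC scale0r scale1r add0r => E.
  have := congr1 psi E; rewrite linearD !linearZ/= psi_d add0r psi_a.
  move=> /(mulIf (lt0r_neq0 h0)) ll; move: E; rewrite ll => /eqP.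
  by rewrite -[eqbRHS]add0r (inj_eq (addIr _)) (negPf d0).
have wV_gt0 : 0 < w^-1 by rewrite invr_gt0.
have st_chart : chart p d a 1 w^-1 = st.
  suff : [set st] (chart p d a 1 w^-1) by [].
  rewrite -hst; split; exists w^-1; rewrite /= ?ltW//.
    rewrite -tp'_chart -{1}p_chart chart_comb; congr chart; field;
      exact: lt0r_neq0.
  by rewrite -q_chart -tq'_chart chart_comb; congr chart; ring.
have sb_chart : chart p d a 0 (- w^-1) = sb.
  suff : [set sb] (chart p d a 0 (- w^-1)) by [].
  rewrite -hsb; split; exists w^-1; rewrite /= ?ltW//.
    by rewrite -bp'_chart -{1}p_chart chart_comb; congr chart; ring.
  rewrite -q_chart -bq'_chart chart_comb; congr chart; field;
    exact: lt0r_neq0.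
have face x : `|x *: d + a| = 1 <-> 0 <= x <= w.
  have psi_xda : psi (x *: d + a) = h.
    by rewrite linearD linearZ/= psi_d mulr0 add0r.
  have -> : `|x *: d + a| = 1 <-> F (x *: d + a) by split=> [|[]].
  rewrite FE; split=> [[t tw]|xw]; last by exists x; rewrite // addrC.
  rewrite addrC => /addrI/eqP.
  by rewrite -subr_eq0 -scalerBl scaler_eq0 (negPf d0) orbF subr_eq0 => /eqP ->.
have := bis_structure p d a w h psi d0 w_gt0 h0 psi_a psi_ker psi_le face.
by rewrite p_chart q_chart tp_chart tq_chart bp_chart bq_chart st_chart
   sb_chart qE.
Qed.
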